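(* The system on $\mathbb{C}^3$ given by $$z_3'=z_2,\qquad z_2'=z_1,\qquad z_1'=-i\frac{z_3}{|z_3|}$$ is Hamiltonian with Hamiltonian $\mathcal{H}_c$ with respect to the Poisson bracket $\{\cdot,\cdot\}_c$, i.e. $z_j'=\{z_j,\mathcal{H}_c\}_c$ for $j=1,2,3$. The angular momentum $\mathcal{A}_c$ is in involution with the Hamiltonian with respect to this bracket: $\{\mathcal{H}_c,\mathcal{A}_c\}_c=0$.
   Context: The system is considered where $z_3\ne0$. The functions are $$\mathcal{H}_c=\frac i2\left(z_2\bar z_1-\bar z_2z_1\right)+\sqrt{z_3\bar z_3},\qquad \mathcal{A}_c=z_2\bar z_2-(z_1\bar z_3+\bar z_1z_3).$$ For smooth functions $A,B$ (extended complex bilinearly to complex-valued functions such as the coordinates $z_j$) define $$\{A,B\}_c=\frac2i\left(\frac{\partial A}{\partial z_1}\frac{\partial B}{\partial\bar z_3}-\frac{\partial A}{\partial\bar z_3}\frac{\partial B}{\partial z_1}\right)+\frac2i\left(-\frac{\partial A}{\partial z_2}\frac{\partial B}{\partial\bar z_2}+\frac{\partial A}{\partial\bar z_2}\frac{\partial B}{\partial z_2}\right)+\frac2i\left(\frac{\partial A}{\partial z_3}\frac{\partial B}{\partial\bar z_1}-\frac{\partial A}{\partial\bar z_1}\frac{\partial B}{\partial z_3}\right),$$ where $\partial/\partial z_j,\partial/\partial\bar z_j$ are Wirtinger derivatives. *)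

(* Defs.v *)
From Stdlib Require Import Reals.
From Coquelicot Require Import Coquelicot.

Open Scope R_scope.
Open Scope C_scope.

Definition C3 : Type := (C * C * C)%type.

Definition z1 (z : C3) : C := fst (fst z).
Definition z2 (z : C3) : C := snd (fst z).
Definition z3 (z : C3) : C := snd z.

(* The basis of C^3 over C; over R, the direction of x_j is [ej] and that of
   y_j is [i ej], where z_j = x_j + i y_j. *)
Definition e1 : C3 := (RtoC 1, RtoC 0, RtoC 0).
Definition e2 : C3 := (RtoC 0, RtoC 1, RtoC 0).
Definition e3 : C3 := (RtoC 0, RtoC 0, RtoC 1).

Definition addC3 (z w : C3) : C3 := (z1 z + z1 w, z2 z + z2 w, z3 z + z3 w).
Definition scalC3 (c : C) (z : C3) : C3 := (c * z1 z, c * z2 z, c * z3 z).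

(* Real derivative at z of the complex-valued f in the direction v, taken on real
   and imaginary parts.  Coquelicot's [Derive] is total: the value is meaningful
   where f is real differentiable. *)
Definition ddir (f : C3 -> C) (v z : C3) : C :=
  (Derive (fun s : R => Re (f (addC3 z (scalC3 (RtoC s) v)))) 0%R,
   Derive (fun s : R => Im (f (addC3 z (scalC3 (RtoC s) v)))) 0%R).

(* Wirtinger derivatives: with e = ej,
   d/dz_j = (d/dx_j - i d/dy_j)/2 and d/dzbar_j = (d/dx_j + i d/dy_j)/2. *)
Definition dz (e : C3) (f : C3 -> C) (z : C3) : C :=
  (ddir f e z - Ci * ddir f (scalC3 Ci e) z) / RtoC 2.
Definition dzbar (e : C3) (f : C3 -> C) (z : C3) : C :=
  (ddir f e z + Ci * ddir f (scalC3 Ci e) z) / RtoC 2.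

Definition bracket_c (A B : C3 -> C) (z : C3) : C :=
    RtoC 2 / Ci * (dz e1 A z * dzbar e3 B z - dzbar e3 A z * dz e1 B z)
  + RtoC 2 / Ci * (- (dz e2 A z * dzbar e2 B z) + dzbar e2 A z * dz e2 B z)
  + RtoC 2 / Ci * (dz e3 A z * dzbar e1 B z - dzbar e1 A z * dz e3 B z).

(* H_c and A_c are real-valued; they are given the codomain C since the bracket is
   extended bilinearly to complex-valued functions.  [Re] only casts the nonnegative
   real number z_3 zbar_3 to R, so that the real square root applies. *)
Definition H_c (z : C3) : C :=
  Ci / RtoC 2 * (z2 z * Cconj (z1 z) - Cconj (z2 z) * z1 z)
  + RtoC (sqrt (Re (z3 z * Cconj (z3 z)))).

Definition A_c (z : C3) : C :=
  z2 z * Cconj (z2 z) - (z1 z * Cconj (z3 z) + Cconj (z1 z) * z3 z).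

(* Components are in the order (z_1', z_2', z_3'). *)
Definition system_field (z : C3) : C3 :=
  (- Ci * (z3 z / RtoC (Cmod (z3 z))), z1 z, z2 z).

(* w is the time derivative at t of the curve c : R -> C; C is a real normed space
   here, so this is the ordinary derivative in a real variable. *)
Definition has_deriv (c : R -> C) (t : R) (w : C) : Prop :=
  @is_derive R_AbsRing C_R_NormedModule c t w.

Definition ode_at (F : C3 -> C3) (c : R -> C3) (t : R) : Prop :=
  has_deriv (fun s => z1 (c s)) t (z1 (F (c t))) /\
  has_deriv (fun s => z2 (c s)) t (z2 (F (c t))) /\
  has_deriv (fun s => z3 (c s)) t (z3 (F (c t))).

(* Main.v *)
Require Import Defs.
From Stdlib Require Import Reals Lra.
From Coquelicot Require Import Coquelicot.

Open Scope R_scope.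
Open Scope C_scope.

(** Wirtinger derivatives are read off from the real differential.  Every
    real-linear form on C^3 can be written uniquely as
    v |-> sum_j (p_j v_j + q_j conj v_j), and when this form is the differential
    of f, p_j is df/dz_j and q_j is df/dzbar_j ([has_differential_wirtinger]).

    The forms of the coordinates, of the Hamiltonian and of the angular momentum
    come from the sum and product rules along a line z + s v; the only
    nonalgebraic ingredient is d|z_3| = (conj z_3 dz_3 + z_3 d(conj z_3)) / (2|z_3|),
    valid away from z_3 = 0 ([curve_deriv_modulus]).  This gives
<<
      dH = (i/2) (z_1b dz_2 - z_1 dz_2b + z_2 dz_1b - z_2b dz_1) + d|z_3|
      dA = z_2b dz_2 + z_2 dz_2b - z_3b dz_1 - z_1 dz_3b - z_3 dz_1b - z_1b dz_3
>>
    (b for the conjugate).  Pairing z_1, z_2, z_3 with H selects the coefficients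
    of dz_3b, dz_2b, dz_1b in dH, which are the right-hand sides of the system up
    to the factors of the bracket.  In the bracket of H and A the terms from the
    modulus, both equal to |z_3| / 2 up to sign, cancel between the first and the
    third summand, and the remaining quadratic terms cancel against the second. *)

(** * Differentiation of complex-valued functions of a real variable *)

(** Stated on real and imaginary parts because directional derivatives in C^3
    are taken that way. *)
Definition curve_deriv (g : R -> C) (t : R) (w : C) : Prop :=
  is_derive (fun s => Re (g s)) t (Re w) /\ is_derive (fun s => Im (g s)) t (Im w).

Lemma curve_deriv_eq (g : R -> C) (t : R) (w w' : C) :
  curve_deriv g t w -> w = w' -> curve_deriv g t w'.
Proof. now intros H <-. Qed.

Lemma curve_deriv_const (c : C) (t : R) : curve_deriv (fun _ => c) t 0.
Proof. split; apply (is_derive_const (V := R_NormedModule)). Qed.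

Lemma curve_deriv_affine (a b : C) : curve_deriv (fun s => a + RtoC s * b) 0%R b.
Proof.
destruct a as [a1 a2], b as [b1 b2]; split; simpl;
  auto_derive; trivial; ring.
Qed.

Lemma curve_deriv_conj (g : R -> C) (t : R) (w : C) :
  curve_deriv g t w -> curve_deriv (fun s => Cconj (g s)) t (Cconj w).
Proof.
intros [Hr Hi]; split; [exact Hr|].
exact (is_derive_opp (V := R_NormedModule) _ _ _ Hi).
Qed.

Lemma curve_deriv_plus (g h : R -> C) (t : R) (v w : C) :
  curve_deriv g t v -> curve_deriv h t w ->
  curve_deriv (fun s => g s + h s) t (v + w).
Proof.
intros [Gr Gi] [Hr Hi]; split; simpl.
- exact (is_derive_plus (V := R_NormedModule) _ _ _ _ _ Gr Hr).
- exact (is_derive_plus (V := R_NormedModule) _ _ _ _ _ Gi Hi).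
Qed.

Lemma curve_deriv_opp (g : R -> C) (t : R) (v : C) :
  curve_deriv g t v -> curve_deriv (fun s => - g s) t (- v).
Proof.
intros [Gr Gi]; split; simpl.
- exact (is_derive_opp (V := R_NormedModule) _ _ _ Gr).
- exact (is_derive_opp (V := R_NormedModule) _ _ _ Gi).
Qed.

Lemma curve_deriv_minus (g h : R -> C) (t : R) (v w : C) :
  curve_deriv g t v -> curve_deriv h t w ->
  curve_deriv (fun s => g s - h s) t (v - w).
Proof. intros G H; exact (curve_deriv_plus _ _ _ _ _ G (curve_deriv_opp _ _ _ H)). Qed.

Lemma curve_deriv_mult (g h : R -> C) (t : R) (v w : C) :
  curve_deriv g t v -> curve_deriv h t w ->
  curve_deriv (fun s => g s * h s) t (v * h t + g t * w).
Proof.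
intros [Gr Gi] [Hr Hi].
pose (x s := Re (g s)); pose (y s := Im (g s)).
pose (u s := Re (h s)); pose (k s := Im (h s)).
change (is_derive x t (Re v)) in Gr; change (is_derive y t (Im v)) in Gi.
change (is_derive u t (Re w)) in Hr; change (is_derive k t (Im w)) in Hi.
assert (Dx := is_derive_unique _ _ _ Gr : Derive (fun s => x s) t = Re v).
assert (Dy := is_derive_unique _ _ _ Gi : Derive (fun s => y s) t = Im v).
assert (Du := is_derive_unique _ _ _ Hr : Derive (fun s => u s) t = Re w).
assert (Dk := is_derive_unique _ _ _ Hi : Derive (fun s => k s) t = Im w).
split.
- apply (is_derive_ext (fun s => x s * u s - y s * k s)%R); [reflexivity|].
  auto_derive.
  + repeat split; eexists; eassumption.
  + rewrite Dx, Dy, Du, Dk; unfold x, y, u, k, Re, Im; simpl; ring.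
- apply (is_derive_ext (fun s => x s * k s + y s * u s)%R); [reflexivity|].
  auto_derive.
  + repeat split; eexists; eassumption.
  + rewrite Dx, Dy, Du, Dk; unfold x, y, u, k, Re, Im; simpl; ring.
Qed.

Lemma Cmod_sqrt_conj (c : C) : Cmod c = sqrt (Re (c * Cconj c)).
Proof. unfold Cmod, Re; simpl; f_equal; ring. Qed.

Lemma Cmod_neq_0 (c : C) : c <> RtoC 0 -> RtoC (Cmod c) <> RtoC 0.
Proof. intros Hc E; apply Hc, Cmod_eq_0; now injection E. Qed.

(** Differentiate |g|^2 = g conj g and apply the chain rule for the square root,
    which is differentiable where g does not vanish. *)
Lemma curve_deriv_modulus (g : R -> C) (t : R) (w : C) :
  curve_deriv g t w -> g t <> RtoC 0 ->
  curve_deriv (fun s => RtoC (sqrt (Re (g s * Cconj (g s))))) t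
    ((Cconj (g t) * w + g t * Cconj w) / (RtoC 2 * RtoC (Cmod (g t)))).
Proof.
intros G Hg.
assert (Hm : (0 < Cmod (g t))%R) by now apply Cmod_gt_0.
destruct (curve_deriv_mult _ _ _ _ _ G (curve_deriv_conj _ _ _ G)) as [N _].
pose (n s := Re (g s * Cconj (g s))).
change (is_derive n t (Re (w * Cconj (g t) + g t * Cconj w))) in N.
assert (Dn := is_derive_unique _ _ _ N :
  Derive (fun s => n s) t = Re (w * Cconj (g t) + g t * Cconj w)).
assert (Hn : (0 < n t)%R).
{ destruct (Rlt_or_le 0 (n t)) as [|H]; trivial.
  rewrite Cmod_sqrt_conj in Hm; fold (n t) in Hm.
  rewrite (sqrt_neg_0 _ H) in Hm; lra. }
apply (curve_deriv_eq _ _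
  (RtoC (/ (2 * Cmod (g t)) * Re (w * Cconj (g t) + g t * Cconj w)))%R).
- split.
  + apply (is_derive_ext (fun s => sqrt (n s))); [reflexivity|].
    auto_derive; [repeat split; trivial; eexists; eassumption|].
    rewrite Dn, Cmod_sqrt_conj; fold (n t).
    change (Re (RtoC ?a)) with a.
    field; apply Rgt_not_eq, sqrt_lt_R0, Hn.
  + exact (is_derive_const (V := R_NormedModule) 0%R t).
- (* The numerator is its own conjugate, hence equals its real part. *)
  assert (E : Cconj (g t) * w + g t * Cconj w =
              RtoC (Re (w * Cconj (g t) + g t * Cconj w))).
  { destruct (g t), w; unfold Cmult, Cplus, Cconj, RtoC, Re; simpl; f_equal; ring. }
  rewrite E, RtoC_mult, RtoC_inv, RtoC_mult; [|lra].
  unfold Cdiv; ring.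
Qed.

(** * Real differentials and Wirtinger derivatives *)

Definition wirtinger_form (p q v : C3) : C :=
  z1 p * z1 v + z1 q * Cconj (z1 v)
  + (z2 p * z2 v + z2 q * Cconj (z2 v))
  + (z3 p * z3 v + z3 q * Cconj (z3 v)).

(** A Gateaux differential, since the Wirtinger derivatives only see the
    directional derivatives. *)
Definition has_differential (f : C3 -> C) (z p q : C3) : Prop :=
  forall v, curve_deriv (fun s => f (addC3 z (scalC3 (RtoC s) v))) 0%R
              (wirtinger_form p q v).

Lemma has_differential_ddir (f : C3 -> C) (z p q v : C3) :
  has_differential f z p q -> ddir f v z = wirtinger_form p q v.
Proof.
intros H; destruct (H v) as [Hr Hi].
rewrite (surjective_pairing (wirtinger_form p q v)).
exact (f_equal2 pair (is_derive_unique _ _ _ Hr) (is_derive_unique _ _ _ Hi)).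
Qed.

Lemma RtoC_2_neq_0 : RtoC 2 <> RtoC 0.
Proof. intros E; injection E; lra. Qed.

Lemma Ci_sqr : Ci * Ci = - RtoC 1.
Proof. unfold Ci, Cmult, Copp, RtoC; simpl; f_equal; ring. Qed.

Lemma Cconj_R (r : R) : Cconj (RtoC r) = RtoC r.
Proof. unfold Cconj, RtoC; simpl; f_equal; ring. Qed.

Lemma Cconj_Ci : Cconj Ci = - Ci.
Proof. unfold Cconj, Ci, Copp; simpl; f_equal; ring. Qed.

(** On the direction e_j the form takes the value p_j + q_j, and on i e_j the
    value i (p_j - q_j). *)
Lemma has_differential_wirtinger (f : C3 -> C) (z p q : C3) :
  has_differential f z p q ->
  (dz e1 f z = z1 p /\ dz e2 f z = z2 p /\ dz e3 f z = z3 p) /\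
  (dzbar e1 f z = z1 q /\ dzbar e2 f z = z2 q /\ dzbar e3 f z = z3 q).
Proof.
intros H; unfold dz, dzbar; rewrite !(has_differential_ddir _ _ _ _ _ H).
unfold wirtinger_form.
assert (H2 := RtoC_2_neq_0); assert (Hi := Ci_sqr).
repeat split; unfold e1, e2, e3, scalC3, z1, z2, z3; cbn [fst snd];
  rewrite ?Cmult_conj, ?Cconj_Ci, ?Cconj_R; field [Hi]; exact H2.
Qed.

Lemma bracket_c_of_differentials (A B : C3 -> C) (z p q r s : C3) :
  has_differential A z p q -> has_differential B z r s ->
  bracket_c A B z =
    RtoC 2 / Ci * (z1 p * z3 s - z3 q * z1 r)
  + RtoC 2 / Ci * (- (z2 p * z2 s) + z2 q * z2 r)
  + RtoC 2 / Ci * (z3 p * z1 s - z1 q * z3 r).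
Proof.
intros HA HB; unfold bracket_c.
destruct (has_differential_wirtinger _ _ _ _ HA) as [[-> [-> ->]] [-> [-> ->]]].
destruct (has_differential_wirtinger _ _ _ _ HB) as [[-> [-> ->]] [-> [-> ->]]].
reflexivity.
Qed.

(** * The coordinates, the Hamiltonian and the angular momentum *)

Lemma Ci_neq_0 : Ci <> RtoC 0.
Proof. intros E; injection E; lra. Qed.

Definition zero3 : C3 := (RtoC 0, RtoC 0, RtoC 0).

Lemma z1_differential (z : C3) : has_differential z1 z e1 zero3.
Proof.
intros v; apply (curve_deriv_eq _ _ _ _ (curve_deriv_affine (z1 z) (z1 v))).
unfold wirtinger_form, e1, zero3, z1, z2, z3; simpl; ring.
Qed.

Lemma z2_differential (z : C3) : has_differential z2 z e2 zero3.
Proof.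
intros v; apply (curve_deriv_eq _ _ _ _ (curve_deriv_affine (z2 z) (z2 v))).
unfold wirtinger_form, e2, zero3, z1, z2, z3; simpl; ring.
Qed.

Lemma z3_differential (z : C3) : has_differential z3 z e3 zero3.
Proof.
intros v; apply (curve_deriv_eq _ _ _ _ (curve_deriv_affine (z3 z) (z3 v))).
unfold wirtinger_form, e3, zero3, z1, z2, z3; simpl; ring.
Qed.

Lemma line_at_0 (z v : C3) : addC3 z (scalC3 (RtoC 0) v) = z.
Proof.
destruct z as [[a b] c]; unfold addC3, scalC3, z1, z2, z3; simpl.
f_equal; [f_equal|]; ring.
Qed.

Lemma H_c_differential (z : C3) : z3 z <> RtoC 0 ->
  has_differential H_c z
    (- (Ci / RtoC 2 * Cconj (z2 z)), Ci / RtoC 2 * Cconj (z1 z),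
     Cconj (z3 z) / (RtoC 2 * RtoC (Cmod (z3 z))))
    (Ci / RtoC 2 * z2 z, - (Ci / RtoC 2 * z1 z),
     z3 z / (RtoC 2 * RtoC (Cmod (z3 z)))).
Proof.
intros Hz v.
assert (Hm := Cmod_neq_0 _ Hz).
assert (H2 := RtoC_2_neq_0).
pose (l s := addC3 z (scalC3 (RtoC s) v)).
assert (D1 : curve_deriv (fun s => z1 (l s)) 0%R (z1 v)) by apply curve_deriv_affine.
assert (D2 : curve_deriv (fun s => z2 (l s)) 0%R (z2 v)) by apply curve_deriv_affine.
assert (D3 : curve_deriv (fun s => z3 (l s)) 0%R (z3 v)) by apply curve_deriv_affine.
unfold H_c; fold l.
eapply curve_deriv_eq.
- apply curve_deriv_plus.
  + apply curve_deriv_mult; [apply curve_deriv_const|].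
    exact (curve_deriv_minus _ _ _ _ _
      (curve_deriv_mult _ _ _ _ _ D2 (curve_deriv_conj _ _ _ D1))
      (curve_deriv_mult _ _ _ _ _ (curve_deriv_conj _ _ _ D2) D1)).
  + apply (curve_deriv_modulus (fun s => z3 (l s)) _ _ D3).
    now unfold l; rewrite line_at_0.
- cbv beta; unfold l; rewrite !line_at_0; unfold wirtinger_form.
  change (z1 (?a, ?b, ?c)) with a; change (z2 (?a, ?b, ?c)) with b;
  change (z3 (?a, ?b, ?c)) with c.
  field; auto.
Qed.

Lemma A_c_differential (z : C3) :
  has_differential A_c z
    (- Cconj (z3 z), Cconj (z2 z), - Cconj (z1 z)) (- z3 z, z2 z, - z1 z).
Proof.
intros v.
pose (l s := addC3 z (scalC3 (RtoC s) v)).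
assert (D1 : curve_deriv (fun s => z1 (l s)) 0%R (z1 v)) by apply curve_deriv_affine.
assert (D2 : curve_deriv (fun s => z2 (l s)) 0%R (z2 v)) by apply curve_deriv_affine.
assert (D3 : curve_deriv (fun s => z3 (l s)) 0%R (z3 v)) by apply curve_deriv_affine.
unfold A_c; fold l.
eapply curve_deriv_eq.
- exact (curve_deriv_minus _ _ _ _ _
    (curve_deriv_mult _ _ _ _ _ D2 (curve_deriv_conj _ _ _ D2))
    (curve_deriv_plus _ _ _ _ _
      (curve_deriv_mult _ _ _ _ _ D1 (curve_deriv_conj _ _ _ D3))
      (curve_deriv_mult _ _ _ _ _ (curve_deriv_conj _ _ _ D1) D3))).
- cbv beta; unfold l; rewrite !line_at_0; unfold wirtinger_form.
  change (z1 (?a, ?b, ?c)) with a; change (z2 (?a, ?b, ?c)) with b;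
  change (z3 (?a, ?b, ?c)) with c.
  ring.
Qed.

(** * The Hamiltonian form of the system and the involution *)

Lemma system_field_bracket (z : C3) : z3 z <> RtoC 0 ->
  z1 (system_field z) = bracket_c z1 H_c z /\
  z2 (system_field z) = bracket_c z2 H_c z /\
  z3 (system_field z) = bracket_c z3 H_c z.
Proof.
intros Hz.
assert (Hm := Cmod_neq_0 _ Hz); assert (HH := H_c_differential z Hz).
assert (H2 := RtoC_2_neq_0).
rewrite (bracket_c_of_differentials _ _ _ _ _ _ _ (z1_differential z) HH),
  (bracket_c_of_differentials _ _ _ _ _ _ _ (z2_differential z) HH),
  (bracket_c_of_differentials _ _ _ _ _ _ _ (z3_differential z) HH).
assert (Hi := Ci_neq_0).
unfold system_field, e1, e2, e3, zero3;
  change (z1 (?a, ?b, ?c)) with a; change (z2 (?a, ?b, ?c)) with b;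
  change (z3 (?a, ?b, ?c)) with c.
repeat split.
- assert (Hsq := Ci_sqr); field [Hsq]; auto.
- field; auto.
- field; auto.
Qed.

Lemma H_c_A_c_involution (z : C3) : z3 z <> RtoC 0 -> bracket_c H_c A_c z = RtoC 0.
Proof.
intros Hz.
assert (Hm := Cmod_neq_0 _ Hz).
assert (H2 := RtoC_2_neq_0).
rewrite (bracket_c_of_differentials _ _ _ _ _ _ _
           (H_c_differential z Hz) (A_c_differential z)).
assert (Hi := Ci_neq_0).
change (z1 (?a, ?b, ?c)) with a; change (z2 (?a, ?b, ?c)) with b;
  change (z3 (?a, ?b, ?c)) with c.
field; auto.
Qed.

Theorem theorem2p6p9 :
  (forall z : C3, z3 z <> RtoC 0 ->
     z1 (system_field z) = bracket_c z1 H_c z /\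
     z2 (system_field z) = bracket_c z2 H_c z /\
     z3 (system_field z) = bracket_c z3 H_c z) /\
  (forall (c : R -> C3) (t : R), z3 (c t) <> RtoC 0 ->
     (ode_at system_field c t <->
      has_deriv (fun s => z1 (c s)) t (bracket_c z1 H_c (c t)) /\
      has_deriv (fun s => z2 (c s)) t (bracket_c z2 H_c (c t)) /\
      has_deriv (fun s => z3 (c s)) t (bracket_c z3 H_c (c t)))) /\
  (forall z : C3, z3 z <> RtoC 0 -> bracket_c H_c A_c z = RtoC 0).
Proof.
split; [exact system_field_bracket|split; [|exact H_c_A_c_involution]].
intros c t Hc; unfold ode_at.
destruct (system_field_bracket _ Hc) as [-> [-> ->]]; reflexivity.
Qed.
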